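(* In the annotation model, for graph streams of an undirected graph with $n$ nodes, there is a valid $(n^2\log n,1)$ protocol for computing the diameter of the graph. Further, any protocol for diameter requires help cost times verification cost $=\Omega(n^2)$ bits.
   Context: Annotation model: a data stream $\mathcal{A}$ of length $m$ is observed by a probabilistic verifier $\mathcal{V}$ (private random string, $w(m)$ machine words of working memory, each word $\Theta(\log m)$ bits) and a deterministic helper $\mathcal{H}$. After the stream ends, $\mathcal{H}$ sends an annotation that $\mathcal{V}$ reads as a stream. $\mathcal{V}$ outputs a value or $\perp$. A helper is valid for $\mathcal{A}$ if $\mathcal{V}$ outputs $f(\mathcal{A})$ with probability 1; it is $\tfrac13$-invalid for $\mathcal{A}$ if $\mathcal{V}$ outputs something other than $\perp$ with probability at most $1/3$. A protocol for $f$ is valid if some helper is valid for every $\mathcal{A}$, and for every helper and every stream, the helper is either valid or $\tfrac13$-invalid. Help cost: maximum annotation length of a shortest valid helper (in words); verification cost: $w(m)$ (in words); lower bounds on their product are in bits. An $(h,v)$ protocol is a valid protocol with help cost $O(h+1)$ and verification cost $O(v+1)$. Graph stream: edges $e_i\in[n]\times[n]$; the diameter is the maximum over pairs of nodes of their hop distance.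
   Formalization: In the lower bound, help cost is replaced by max(1, help cost), since a protocol that stores the graph and uses an empty annotation has help cost 0 and hence product 0. *)

(* Defs.v *)
From mathcomp Require Import all_boot all_order all_algebra.

Set Implicit Arguments.
Unset Strict Implicit.
Unset Printing Implicit Defensive.

(* Theta(log m); the successor keeps words nonempty for m <= 1. *)
Definition word_size (m : nat) : nat := (trunc_log 2 m).+1.

(* Number of words needed to hold b bits: the ceiling of b / word_size m. *)
Definition words (m b : nat) : nat := (b + (word_size m).-1) %/ word_size m.

(* All the state that the verifier carries from one item to the next, including
   any counter of its position, has to fit in the mem_bits bits of memory.  The
   random string is private and read-only, and is not part of the memory.
   The annotation is read as a stream of bits; the output None stands for bot. *)
Record verifier (U T : Type) := Verifier {
  coin_bits : nat;
  mem_bits : nat;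
  init_state : coin_bits.-tuple bool -> mem_bits.-tuple bool;
  read_item :
    coin_bits.-tuple bool -> mem_bits.-tuple bool -> U -> mem_bits.-tuple bool;
  read_annot :
    coin_bits.-tuple bool -> mem_bits.-tuple bool -> bool -> mem_bits.-tuple bool;
  output : coin_bits.-tuple bool -> mem_bits.-tuple bool -> option T
}.

Definition run (U T : Type) (V : verifier U T) (A : seq U) (a : seq bool)
    (r : (coin_bits V).-tuple bool) : option T :=
  output r (foldl (read_annot r) (foldl (read_item r) (init_state r) A) a).

(* Probability over a uniformly random string of k bits. *)
Definition prob (k : nat) (E : pred (k.-tuple bool)) : rat :=
  (#|[set r | E r]|%:R / #|{: k.-tuple bool}|%:R)%R.

Section Annotations.

Variables (U : finType) (T : eqType) (m : nat).

(* The helper sees the whole stream, but not the random string. *)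
Definition helper : Type := m.-tuple U -> seq bool.

Variables (f : m.-tuple U -> T) (V : verifier U T).

Definition helper_valid_for (H : helper) (A : m.-tuple U) : Prop :=
  prob (fun r => run (V := V) A (H A) r == Some (f A)) = 1%R.

Definition helper_invalid_for (delta : rat) (H : helper) (A : m.-tuple U) :
    Prop :=
  (prob (fun r => run (V := V) A (H A) r != None) <= delta)%R.

Definition valid_helper (H : helper) : Prop :=
  forall A, helper_valid_for H A.

Definition valid_verifier : Prop :=
  (exists H, valid_helper H) /\
  (forall H A, helper_valid_for H A \/ helper_invalid_for (1 / 3%:R)%R H A).

Definition annotation_length (H : helper) : nat :=
  \max_(A : m.-tuple U) size (H A).

(* In bits. *)
Definition is_help_cost (c : nat) : Prop :=
  (exists2 H, valid_helper H & annotation_length H = c) /\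
  (forall H, valid_helper H -> c <= annotation_length H).

End Annotations.

Section HopDistance.

Variables (S : finType) (e : rel S).

Definition walk (x y : S) (k : nat) : bool :=
  [exists p : k.-tuple S, path e x p && (last x p == y)].

Lemma connect_walk (x y : S) : connect e x y -> exists k, walk x y k.
Proof.
case/connectP=> p e_p ->; exists (size p).
by apply/existsP; exists (in_tuple p); rewrite e_p eqxx.
Qed.

(* None is the infinite distance. *)
Definition hop_distance (x y : S) : option nat :=
  match @idP (connect e x y) with
  | ReflectT xy => Some (ex_minn (connect_walk xy))
  | ReflectF _ => None
  end.

Definition max_distance (a b : option nat) : option nat :=
  match a, b with
  | Some i, Some j => Some (maxn i j)
  | _, _ => None
  end.

Definition rel_diameter : option nat :=
  \big[max_distance/Some 0]_(p : S * S) hop_distance p.1 p.2.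

End HopDistance.

(* Repeated edges and self-loops may occur in the stream. *)
Definition stream_adj (n m : nat) (A : m.-tuple ('I_n * 'I_n)) : rel 'I_n :=
  fun x y => ((x, y) \in A) || ((y, x) \in A).

Definition diameter (n m : nat) (A : m.-tuple ('I_n * 'I_n)) : option nat :=
  rel_diameter (stream_adj A).

(* A verifier for each number n of nodes and each stream length m. *)
Definition graph_protocol (T : Type) : Type :=
  forall n m : nat, verifier ('I_n * 'I_n) T.

Definition graph_problem (T : Type) : Type :=
  forall n m : nat, m.-tuple ('I_n * 'I_n) -> T.

Definition valid_protocol (T : eqType) (f : graph_problem T)
    (P : graph_protocol T) : Prop :=
  forall n m : nat, 0 < n -> valid_verifier (@f n m) (P n m).

(* An (h, v) protocol, with h and v functions of the number of nodes. *)
Definition hv_protocol (T : eqType) (f : graph_problem T)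
    (P : graph_protocol T) (h v : nat -> nat) : Prop :=
  valid_protocol f P /\
  exists C : nat, forall n m : nat, 0 < n ->
    (exists2 c, is_help_cost (@f n m) (P n m) c & words m c <= C * (h n + 1)) /\
    words m (mem_bits (P n m)) <= C * (v n + 1).

(* Main.v *)
(** For the lower bound, the answers of 4 + c independent copies of the verifier
    on all annotations of at most c bits are, by a union bound, almost never
    wrong, so the states after the first part of a stream form a one-way message
    for INDEX; a graph with a hub has diameter at most 3 exactly when a queried
    edge is present, and the number of sets that a message can describe up to
    few errors is counted with weights.

    For the protocol, the helper sends for every pair (z, x) the weight s(z, x)
    of the edge between z and x, the distance d(z, x) from x to z, and numbers
    c_0, c_1, c_2 of neighbours of z that are one step closer to x, equally far
    and one step farther.  The distances are right as soon as, for all x, y, k,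
    the sum over z of s(z, y) [d(z, x) = k] is the claimed number of neighbours
    of y at distance k from x.  Weighting this identity with random bits
    alpha_y beta_(x, k) turns the left-hand side into a sum over z of products
    (sum_y alpha_y s(z, y)) (sum_x beta_(x, d(z, x))), which one pass over the
    annotation evaluates in three words.  The weights s are compared with the
    stream by another random sum, added to the same accumulator.  A failing
    identity is missed with probability at most 3/4, and four copies bring this
    below 1/3.  A stream with fewer than n - 1 edges has no room for a word of
    Theta(log n) bits, but then the graph is disconnected. *)
Require Import Defs.
From mathcomp Require Import all_boot all_order all_algebra.
From mathcomp Require Import zify.
Set Implicit Arguments.
Unset Strict Implicit.
Unset Printing Implicit Defensive.

Import GRing.Theory Num.Theory.

(** * Lower bound *)

Lemma prob_eq1 (k : nat) (E : pred (k.-tuple bool)) :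
  prob E = 1%R <-> forall r, E r.
Proof.
have cardT : (#|{: k.-tuple bool}|%:R != 0 :> rat)%R.
  by rewrite pnatr_eq0 -lt0n card_tuple card_bool expn_gt0.
rewrite /prob; split=> [/(canRL (mulfVK cardT)) | allE].
  rewrite mul1r => /eqP; rewrite eqr_nat -cardsT => cardE r.
  have : [set r | E r] == setT by rewrite eqEcard subsetT (eqP cardE) /=.
  by move/eqP/setP/(_ r); rewrite !inE.
rewrite (_ : [set r | E r] = setT) ?cardsT ?divff //.
by apply/setP=> r; rewrite !inE allE.
Qed.

Lemma prob_le_third (k : nat) (E : pred (k.-tuple bool)) :
  (prob E <= 1 / 3%:R)%R = (3 * #|[set r | E r]| <= #|{: k.-tuple bool}|).
Proof.
have cardT : (0 < #|{: k.-tuple bool}|%:R :> rat)%R.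
  by rewrite ltr0n card_tuple card_bool expn_gt0.
rewrite /prob ler_pdivrMr // mulrAC ler_pdivlMr ?ltr0n // mul1r mulrC.
by rewrite -natrM ler_nat.
Qed.

Definition bounded (k : nat) (a : option nat) : bool :=
  if a is Some d then d <= k else false.

Lemma hop_distance_bounded (S : finType) (e : rel S) (k : nat) (x y : S) :
  reflect (exists p, [/\ path e x p, last x p = y & size p <= k])
          (bounded k (hop_distance e x y)).
Proof.
rewrite /hop_distance; case: {-}_ / idP => [xy | not_xy].
  apply: (iffP idP); case: ex_minnP => d.
    by case/existsP=> q /andP[e_q /eqP last_q] _; exists q; rewrite size_tuple.
  move=> _ min_d [p [e_p last_p]]; apply: leq_trans; apply: min_d.
  by apply/existsP; exists (in_tuple p); rewrite e_p last_p eqxx.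
right; case=> p [e_p last_p _]; case: not_xy.
by apply/connectP; exists p.
Qed.

Lemma rel_diameter_bounded (S : finType) (e : rel S) (k : nat) :
  reflect (forall x y, bounded k (hop_distance e x y))
          (bounded k (rel_diameter e)).
Proof.
have max_bounded : {morph bounded k : a b / max_distance a b >-> a && b}.
  by move=> [i|] [j|] //=; rewrite ?geq_max ?andbF.
rewrite /rel_diameter (big_morph _ max_bounded (erefl : bounded k (Some 0) = true)).
rewrite big_andE.
by apply: (iffP forallP) => [le_k x y | le_k [x y]] //=; apply: (le_k (x, y)).
Qed.

(** * One-way messages for INDEX, by weighted counting *)

(** The sum factors over the points of [I]: a point of [y] contributes 2 if it lies in [x] and 1 if
    it does not, 3 in all, while a point outside [y] contributes 2. *)
Lemma sum_subset_pow (I : finType) (y : {set I}) :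
  \sum_(x : {set I} | x \subset y) 2 ^ (#|I| - #|y :\: x|) <= 3 ^ #|I|.
Proof.
pose F i := if i \in y then 2 else 0; pose G i := if i \in y then 1 else 2.
apply: (@leq_trans (\prod_i (F i + G i))); last first.
  have <- : \prod_(i : I) 3 = 3 ^ #|I| by rewrite prod_nat_const.
  by apply: leq_prod => i _; rewrite /F /G; case: ifP.
rewrite bigA_distr /= [leqRHS](bigID (fun x : {set I} => x \subset y)) /=.
apply: leq_trans (leq_addr _ _); apply/eq_leq/eq_bigr => x sxy.
rewrite [RHS](eq_bigr (fun i => if i \in ~: (y :\: x) then 2 else 1)); last first.
  move=> i _; rewrite /F /G !inE; have := subsetP sxy i.
  by case: (i \in x) => [->|_] //; case: ifP.
by rewrite -big_mkcond prod_nat_const [#|~: _|]cardsCs setCK.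
Qed.

(** Averaging fixes an [r] with at most N/16 wrong elements per set on average; by Markov, at least
    half of the sets then have at most N/8. Sets with the same message all lie inside one decoded
    set, so their weights 2^(N - errors) add up to at most 3^N. As 3 < 2^(15/8), this forces
    exponentially many messages. *)
Lemma index_message_bound (I C M : finType) (msg : C -> {set I} -> M)
    (dec : C -> M -> {set I}) :
  0 < #|C| -> (forall r (x : {set I}), x \subset dec r (msg r x)) ->
  (forall (x : {set I}) i, i \notin x ->
     16 * #|[set r | i \in dec r (msg r x)]| <= #|C|) ->
  2 ^ (2 * #|I| - 1 - #|I| %/ 8) <= #|M| * 3 ^ #|I|.
Proof.
move=> C_gt0 sub_dec err; set N := #|I|.
have card_set : #|{: {set I}}| = 2 ^ N.
  by rewrite -cardsT -powersetT card_powerset cardsT.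
pose wrong r x := dec r (msg r x) :\: x.
have total : 16 * \sum_r \sum_x #|wrong r x| <= #|C| * (2 ^ N * N).
  rewrite exchange_big /= big_distrr /=.
  apply: (@leq_trans (\sum_(x : {set I}) #|C| * N)); last first.
    by rewrite sum_nat_const [#|_|]card_set mulnCA.
  apply: leq_sum => x _.
  have -> : \sum_r #|wrong r x|
            = \sum_(i in ~: x) #|[set r | i \in dec r (msg r x)]|.
    under eq_bigr => r _ do rewrite -sum1_card big_mkcond.
    rewrite exchange_big [RHS]big_mkcond; apply: eq_bigr => i _ /=.
    rewrite inE; case: ifP => xi.
      by rewrite -sum1_card [RHS]big_mkcond; apply: eq_bigr => r _; rewrite !inE xi.
    by rewrite big1 // => r _; rewrite !inE xi.
  rewrite big_distrr /=; apply: (@leq_trans (\sum_(i in ~: x) #|C|)).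
    by apply: leq_sum => i; rewrite inE; apply: err.
  by rewrite sum_nat_const mulnC leq_mul2l max_card orbT.
have [r le_r] : exists r, 16 * \sum_x #|wrong r x| <= 2 ^ N * N.
  apply/existsP; apply: contraLR total => /existsPn gt_r.
  rewrite -ltnNge big_distrr /= -sum_nat_const.
  have /card_gt0P[r0 _] := C_gt0.
  rewrite (bigD1 r0) //= [ltnRHS](bigD1 r0) //= -addSn leq_add //.
    by rewrite ltnNge gt_r.
  by apply: leq_sum => r _; rewrite ltnW // ltnNge gt_r.
pose t := N %/ 8; pose Good := [set x | #|wrong r x| <= t].
have lt_N : N < 8 * t.+1 by rewrite /t; lia.
have card_Good : 2 ^ N <= 2 * #|Good|.
  have [N0 | N_gt0] := posnP N.
    suff : 0 < #|Good| by rewrite N0; lia.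
    apply/card_gt0P; exists set0; rewrite inE.
    by apply: leq_trans (max_card _) _; rewrite -/N N0.
  have cardP : #|Good| + #|~: Good| = 2 ^ N.
    by rewrite cardsC card_set.
  have : t.+1 * #|~: Good| <= \sum_x #|wrong r x|.
    rewrite mulnC -sum_nat_const big_mkcond /=; apply: leq_sum => x _.
    by rewrite !inE; case: ifP => //; rewrite -ltnNge.
  have : 2 ^ N > 0 by rewrite expn_gt0.
  nia.
have sumE : #|Good| * 2 ^ (N - t) <= #|M| * 3 ^ N.
  rewrite -!sum_nat_const.
  apply: (@leq_trans (\sum_(x in Good) 2 ^ (N - #|wrong r x|))).
    by apply: leq_sum => x; rewrite inE => le_t; rewrite leq_pexp2l // leq_sub2l.
  rewrite (partition_big (msg r) predT) //=; apply: leq_sum => mu _.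
  apply: leq_trans (sum_subset_pow (dec r mu)).
  rewrite big_mkcond [leqRHS]big_mkcond; apply: leq_sum => x _ /=.
  by case: ifP => // /andP[_ /eqP <-]; rewrite sub_dec.
(* For N = 0 the truncated subtraction makes the exponent 0, and one good set suffices. *)
have [N0 | N_gt0] := posnP N.
  by apply: leq_trans sumE; move: card_Good;
    rewrite N0 /t N0 div0n expn0 muln1; case: #|_|.
apply: leq_trans sumE; rewrite -(leq_pmul2l (ltn0Sn 1)) mulnA.
have -> : 2 * 2 ^ (2 * N - 1 - t) = 2 ^ N * 2 ^ (N - t).
  rewrite -expnS -expnD; congr (2 ^ _).
  have : t <= N by rewrite leq_div.
  have : t < N by rewrite /t; lia.
  lia.
by rewrite leq_mul2r card_Good orbT.
Qed.

Lemma leq_exp_base (e m n : nat) : m <= n -> m ^ e <= n ^ e.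
Proof. by case: e => // e; rewrite leq_exp2r. Qed.

Lemma card_ffun_forall (J R : finType) (E : pred R) :
  #|[set r : {ffun J -> R} | [forall j, E (r j)]]| = #|E| ^ #|J|.
Proof.
rewrite -card_ffun_on; apply: eq_card => r; rewrite !inE.
by apply/forallP/ffun_onP.
Qed.

(** By independence, all copies err on a fixed [a] with probability at most 3^(-|J|); a union bound
    over [a] follows. *)
Lemma card_exists_forall (A J R : finType) (E : A -> pred R) :
  (forall a, 3 * #|E a| <= #|R|) ->
  3 ^ #|J| * #|[set r : {ffun J -> R} | [exists a, [forall j, E a (r j)]]]|
    <= #|A| * #|R| ^ #|J|.
Proof.
move=> leE; pose S a := [set r : {ffun J -> R} | [forall j, E a (r j)]].
apply: (@leq_trans (3 ^ #|J| * \sum_a #|S a|)).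
  rewrite leq_mul2l; apply/orP; right.
  under eq_bigr => a _ do rewrite -sum1_card big_mkcond.
  rewrite exchange_big -sum1_card big_mkcond; apply: leq_sum => r _ /=.
  rewrite inE; case: ifP => // /existsP[a ra].
  by rewrite (bigD1 a) //= inE ra.
rewrite big_distrr /= -sum_nat_const; apply: leq_sum => a _.
by rewrite card_ffun_forall -expnMn leq_exp_base // leE.
Qed.

(** The message is the tuple of states of all copies after Alice's part. Bob tries every annotation
    of at most [c] bits and puts [i] into the set if one of them convinces all copies. The honest
    annotation works for every random string, so no element is lost; false elements are rare by the
    union bound. *)
Lemma index_protocol_bound (U : finType) (T : eqType) (m : nat)
    (f : m.-tuple U -> T) (V : verifier U T) (I : finType) (good : pred T)
    (alice : {set I} -> seq U) (bob : I -> seq U)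
    (stream : {set I} -> I -> m.-tuple U) (c : nat) :
  (forall x i, stream x i = alice x ++ bob i :> seq U) ->
  (forall x i, good (f (stream x i)) = (i \in x)) ->
  valid_verifier f V -> is_help_cost f V c ->
  #|I| <= 4 * ((c + 4) * mem_bits V + 1).
Proof.
move=> streamE goodE [_ sound] [[H validH <-] _]; set c' := annotation_length H.
pose k := c' + 4; pose R : finType := (coin_bits V).-tuple bool.
pose M : finType := (mem_bits V).-tuple bool.
pose answer r (mu : M) i (a : seq bool) :=
  output r (foldl (read_annot (v := V) r) (foldl (read_item r) mu (bob i)) a).
pose says_yes (o : option T) := if o is Some d then good d else false.
pose msg (r : {ffun 'I_k -> R}) x : {ffun 'I_k -> M} :=
  [ffun j => foldl (read_item (r j)) (init_state (r j)) (alice x)].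
pose dec (r : {ffun 'I_k -> R}) (mu : {ffun 'I_k -> M}) : {set I} :=
  [set i | [exists a : {bseq c' of bool},
     [forall j, says_yes (answer (r j) (mu j) i a)]]].
have runE (r : R) x i a :
    run (stream x i) a r
    = answer r (foldl (read_item r) (init_state r) (alice x)) i a.
  by rewrite /run streamE foldl_cat.
have := @index_message_bound I _ _ msg dec.
rewrite !card_ffun !card_tuple card_bool card_ord !expn_gt0 /= => bound.
have {}bound : 2 ^ (2 * #|I| - 1 - #|I| %/ 8)
    <= (2 ^ mem_bits V) ^ k * 3 ^ #|I|.
  apply: bound => // [r x | x i ix].
    apply/subsetP => i ix; rewrite inE; apply/existsP.
    have le_H : size (H (stream x i)) <= c'.
      exact: (leq_bigmax (F := fun A => size (H A))).
    exists (Bseq le_H); apply/forallP => j; rewrite ffunE -runE.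
    have /prob_eq1/(_ (r j))/eqP-> := validH (stream x i).
    by rewrite /= goodE.
  pose E (a : {bseq c' of bool}) : pred R :=
    fun r => says_yes (run (stream x i) a r).
  have leE a : 3 * #|E a| <= #|R|.
    (* A fixed annotation is a constant helper: it is either valid, and then never yields a good
       answer since [i] is not in [x], or it yields any answer with probability at most 1/3. *)
    case: (sound (fun=> val a) (stream x i)) => [/prob_eq1 all_ok | ].
      suff E0 r : E a r = false by rewrite eq_card0 ?muln0.
      have /eqP /= run_r := all_ok r.
      by rewrite /E run_r /= goodE; apply/negbTE.
    rewrite /helper_invalid_for prob_le_third; apply: leq_trans.
    rewrite leq_mul2l /=; apply: subset_leq_card; apply/subsetP => r Er.
    have : E a r by [].
    by rewrite inE /E /=; case: run.
  have := @card_exists_forall _ 'I_k _ E leE.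
  rewrite !card_ord card_tuple card_bool card_bseq card_bool => le_err.
  (* There are fewer than 2^(c'+1) annotations, and 81 * 2^c' >= 16 * 2^(c'+1): this is why four
     extra copies are taken. *)
  have le_annot : 16 * \sum_(i < c'.+1) 2 ^ i <= 3 ^ k.
    have := predn_exp 2 c'.+1; rewrite mul1n => <-.
    rewrite /k expnD expnS; have : 2 ^ c' <= 3 ^ c' by rewrite leq_exp_base.
    lia.
  rewrite -(@leq_pmul2l (3 ^ k)) ?expn_gt0 // mulnCA.
  have -> : [set r | i \in dec r (msg r x)]
      = [set r : {ffun 'I_k -> R} | [exists a, [forall j, E a (r j)]]].
    apply/setP => r; rewrite !inE; apply: eq_existsb => a.
    by apply: eq_forallb => j; rewrite ffunE /E runE.
  apply: leq_trans (leq_mul (leqnn 16) le_err) _.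
  by rewrite mulnA leq_mul2r le_annot orbT.
(* The eighth power clears the division by 8. With 3^8 <= 2^13 and a left exponent of at least 15N -
   8, a linear inequality in N remains. *)
have : (2 ^ (2 * #|I| - 1 - #|I| %/ 8)) ^ 8
    <= 2 ^ (8 * (mem_bits V * k) + 13 * #|I|).
  apply: (@leq_trans (((2 ^ mem_bits V) ^ k * 3 ^ #|I|) ^ 8)).
    by rewrite leq_exp2r.
  rewrite expnMn expnD leq_mul //; first by rewrite -!expnM mulnA mulnC mulnA.
  by rewrite expnAC expnM leq_exp_base.
rewrite -expnM leq_exp2l // => le_exp.
rewrite -/k [k * _]mulnC; move: le_exp; move: (mem_bits V * k) => kv.
by move: #|I| => N; lia.
Qed.

(** * A graph whose diameter answers an INDEX query *)

Section IndexGadget.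

Variables (q n : nat) (u v : 'I_q -> 'I_n) (s t w : 'I_n).
Hypotheses (inj_u : injective u) (inj_v : injective v).
Hypothesis uv : forall a b, u a != v b.
Hypotheses (us : forall a, u a != s) (ut : forall a, u a != t).
Hypotheses (vs : forall a, v a != s) (vt : forall a, v a != t).
Hypotheses (uw : forall a, u a != w) (vw : forall a, v a != w).
Hypotheses (st : s != t) (sw : s != w) (tw : t != w).

(* A missing edge is replaced by a self-loop, so that the length of the stream
   does not depend on the set. *)
Definition gadget_edges (x : {set 'I_q * 'I_q}) : seq ('I_n * 'I_n) :=
  [seq (u p.1, if p \in x then v p.2 else u p.1) | p <- enum {: 'I_q * 'I_q}].

(* w is a hub adjacent to all nodes except s and t. *)
Definition gadget_query (p : 'I_q * 'I_q) : seq ('I_n * 'I_n) :=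
  [:: (s, u p.1), (t, v p.2) &
      [seq (w, if y \in [:: s; t] then w else y) | y <- enum 'I_n]].

Lemma size_gadget (x : {set _}) p :
  size (gadget_edges x ++ gadget_query p) == q * q + n.+2.
Proof.
by rewrite size_cat size_map -cardE card_prod !card_ord /= size_map size_enum_ord.
Qed.

Definition gadget x p : (q * q + n.+2).-tuple ('I_n * 'I_n) :=
  Tuple (size_gadget x p).

Lemma mem_gadget (x : {set _}) p y z :
  (y, z) \in gadget x p ->
  [\/ exists p', [/\ y = u p'.1, z = v p'.2 & p' \in x],
      exists a, y = u a /\ z = u a,
      y = s /\ z = u p.1 \/ y = t /\ z = v p.2 |
      [/\ y = w, z != s & z != t]].
Proof.
rewrite mem_cat => /orP[/mapP[p' _ [-> ->]] | ].
  case: ifP => [xp' | _]; first by apply: Or41; exists p'.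
  by apply: Or42; exists p'.1.
rewrite !inE => /or3P[/eqP[-> ->] | /eqP[-> ->] | /mapP[z' _ [-> ->]]].
- by apply: Or43; left.
- by apply: Or43; right.
apply: Or44; case: ifP => [_ | ]; first by rewrite ![w == _]eq_sym.
by rewrite !inE => /norP[zs zt].
Qed.

Lemma hub_adj (x : {set _}) p z : z != s -> z != t -> (w, z) \in gadget x p.
Proof.
move=> zs zt; rewrite mem_cat !inE; apply/orP; right; apply/or3P/Or33.
apply/mapP; exists z; rewrite ?mem_enum //.
by rewrite !inE (negPf zs) (negPf zt).
Qed.

Lemma gadget_near (x : {set _}) p y z : p \in x ->
  exists l, [/\ path (stream_adj (gadget x p)) y l, last y l = z & size l <= 3].
Proof.
move=> xp; set e := stream_adj _.
have e_sym : symmetric e by move=> a b; rewrite /e /stream_adj orbC.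
have ew a : a != s -> a != t -> e w a.
  by move=> *; rewrite /e /stream_adj hub_adj.
have {}ew a : a != s -> a != t -> (e w a) * (e a w).
  by move=> a_s a_t; rewrite [e a w]e_sym ew.
have es : e s (u p.1).
  by rewrite /e /stream_adj mem_cat !inE eqxx !orbT.
have et : e t (v p.2).
  by rewrite /e /stream_adj mem_cat !inE eqxx !orbT.
have euv : e (u p.1) (v p.2).
  rewrite /e /stream_adj mem_cat; apply/orP; left; apply/orP; left.
  by apply/mapP; exists p; rewrite ?mem_enum //= xp.
have [-> | ys] := eqVneq y s.
  have [-> | zs] := eqVneq z s; first by exists [::].
  have [-> | zt] := eqVneq z t.
    by exists [:: u p.1; v p.2; t]; rewrite /= es euv e_sym et.
  by exists [:: u p.1; w; z]; rewrite /= es !ew.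
have [-> | yt] := eqVneq y t.
  have [-> | zs] := eqVneq z s.
    by exists [:: v p.2; u p.1; s]; rewrite /= et e_sym euv e_sym es.
  have [-> | zt] := eqVneq z t; first by exists [::].
  by exists [:: v p.2; w; z]; rewrite /= et !ew.
have [-> | zs] := eqVneq z s.
  by exists [:: w; u p.1; s]; rewrite /= !ew // e_sym es.
have [-> | zt] := eqVneq z t.
  by exists [:: w; v p.2; t]; rewrite /= !ew // e_sym et.
by exists [:: w; z]; rewrite /= !ew.
Qed.

Lemma gadget_s_adj (x : {set _}) p y : stream_adj (gadget x p) s y -> y = u p.1.
Proof.
case/orP=> /mem_gadget[[p' [E1 E2 _]] | [a [E1 E2]] | [[E1 E2] | [E1 E2]] |
                        [E1 E2 E3]] //.
- by have := us p'.1; rewrite -E1 eqxx.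
- by have := us a; rewrite -E1 eqxx.
- by have := st; rewrite E1 eqxx.
- by have := sw; rewrite E1 eqxx.
- by have := vs p'.2; rewrite -E2 eqxx.
- by have := us a; rewrite -E2 eqxx.
- by have := us p.1; rewrite -E2 eqxx.
- by have := vs p.2; rewrite -E2 eqxx.
by have := E2; rewrite eqxx.
Qed.

Lemma gadget_t_adj (x : {set _}) p y : stream_adj (gadget x p) t y -> y = v p.2.
Proof.
case/orP=> /mem_gadget[[p' [E1 E2 _]] | [a [E1 E2]] | [[E1 E2] | [E1 E2]] |
                        [E1 E2 E3]] //.
- by have := ut p'.1; rewrite -E1 eqxx.
- by have := ut a; rewrite -E1 eqxx.
- by have := st; rewrite E1 eqxx.
- by have := tw; rewrite E1 eqxx.
- by have := vt p'.2; rewrite -E2 eqxx.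
- by have := ut a; rewrite -E2 eqxx.
- by have := ut p.1; rewrite -E2 eqxx.
- by have := vt p.2; rewrite -E2 eqxx.
by have := E3; rewrite eqxx.
Qed.

Lemma gadget_uv_adj (x : {set _}) p : stream_adj (gadget x p) (u p.1) (v p.2) -> p \in x.
Proof.
case/orP=> /mem_gadget[[p' [E1 E2 xp']] | [a [E1 E2]] | [[E1 E2] | [E1 E2]] | [E1 E2 E3]].
- by rewrite [p]surjective_pairing (inj_u E1) (inj_v E2) -surjective_pairing.
- by have := uv a p.2; rewrite E2 eqxx.
- by have := us p.1; rewrite E1 eqxx.
- by have := ut p.1; rewrite E1 eqxx.
- by have := uw p.1; rewrite E1 eqxx.
- by have := uv p'.1 p.2; rewrite E1 eqxx.
- by have := uv a p.2; rewrite E1 eqxx.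
- by have := vs p.2; rewrite E1 eqxx.
- by have := vt p.2; rewrite E1 eqxx.
by have := vw p.2; rewrite E1 eqxx.
Qed.

(** The only neighbour of [s] is [u p.1] and the only neighbour of [t] is [v p.2], so a walk of at
    most three steps between them must cross the edge [p]. Every other pair is joined through the
    hub [w] within three steps. *)
Lemma gadget_diameter (x : {set _}) p : bounded 3 (diameter (gadget x p)) = (p \in x).
Proof.
apply/rel_diameter_bounded/idP => [near | xp y z]; last first.
  exact/hop_distance_bounded/gadget_near.
have /hop_distance_bounded[l [] + + +] := near s t.
have e_sym : symmetric (stream_adj (gadget x p)).
  by move=> a b; rewrite /stream_adj orbC.
case: l => [|a [|b [|c [|d l]]]] //=.
- by move=> _ E; have := st; rewrite E eqxx.
- by rewrite andbT => /gadget_s_adj-> E; have := ut p.1; rewrite E eqxx.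
- case/and3P=> /gadget_s_adj-> + _ E; rewrite {}E e_sym => /gadget_t_adj E.
  by have := uv p.1 p.2; rewrite E eqxx.
case/and4P=> /gadget_s_adj-> ab bc _ E _; move: ab bc.
by rewrite E [_ b t]e_sym => ab /gadget_t_adj Eb; move: ab; rewrite Eb => /gadget_uv_adj.
Qed.

End IndexGadget.

Lemma diameter_lower_bound (P : graph_protocol (option nat)) (n : nat) :
  valid_protocol diameter P -> 16 <= n ->
  exists2 m, m <= n ^ 2 &
  forall c, is_help_cost (@diameter n m) (P n m) c ->
    n ^ 2 <= 640 * (maxn 1 c * mem_bits (P n m)).
Proof.
(* Two sides of [q] nodes each, together with [s], [t] and [w], fit into [n] nodes. *)
move=> validP n_ge16; pose q := (n - 3) %/ 2.
have le_q : 2 * q + 3 <= n by rewrite /q; lia.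
have lt_a (a : 'I_q) : a < n by have := ltn_ord a; lia.
have lt_b (a : 'I_q) : q + a < n by have := ltn_ord a; lia.
have lt_s : 2 * q < n by lia.
have lt_t : (2 * q).+1 < n by lia.
have lt_w : (2 * q).+2 < n by lia.
pose u a := Ordinal (lt_a a); pose v a := Ordinal (lt_b a).
pose s := Ordinal lt_s; pose t := Ordinal lt_t; pose w := Ordinal lt_w.
have ne (a b : 'I_n) : val a <> val b -> a != b.
  by move=> ab; apply/eqP => E; rewrite E in ab.
exists (q * q + n.+2) => [|c costc].
  have : n.+2 <= 2 * n by lia.
  have : q <= n %/ 2 by lia.
  rewrite -mulnn; nia.
have n_gt0 : 0 < n by lia.
have := @index_protocol_bound _ _ _ _ _ _ (bounded 3)
  (gadget_edges u v) (gadget_query u v s t w) (gadget u v s t w) c _ _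
  (validP n _ n_gt0) costc.
rewrite card_prod card_ord => bound.
have {bound} : q * q <= 4 * ((c + 4) * mem_bits (P n (q * q + n.+2)) + 1).
  apply: bound => [// | x p].
  have inj_u : injective u by move=> a b [] /val_inj.
  have inj_v : injective v by move=> a b [] /addnI /val_inj.
  apply: (gadget_diameter inj_u inj_v) => [a b|a|a|a|a|a|a|||];
    by apply: ne => /=; try (have := ltn_ord a); lia.
have cost_c : c + 4 <= 5 * maxn 1 c by lia.
have le_n : n <= 4 * q by rewrite /q; lia.
move: (mem_bits _) cost_c => b; move: (c + 4) (maxn 1 c) => d e le_d le_qq.
have le_db : d * b <= 5 * (e * b) by rewrite mulnA leq_mul2r le_d orbT.
have : n ^ 2 <= 16 * (q * q) by rewrite -mulnn; nia.
(* The bounds so far give n^2 <= 320 e b + 64; the additive 64 is at most a quarter of n^2. *)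
have : 256 <= n ^ 2 by rewrite -mulnn; nia.
lia.
Qed.

(** * Verifiers that read records *)

Lemma words_leq (m b k : nat) : b <= k * word_size m -> words m b <= k.
Proof.
rewrite /words => le_b; rewrite -ltnS ltn_divLR // mulSn; move: le_b.
by rewrite /word_size; lia.
Qed.

(** * Finite types as bit strings *)

Section Coding.

Variables (A B : finType) (a0 : A) (b0 : B).

(** Elements are matched by their ranks in the two enumerations, so the same map encodes in one
    direction and decodes in the other; [b0] stands in for ranks beyond the size of [B]. *)
Definition code (a : A) : B := nth b0 (enum B) (enum_rank a).

End Coding.

Lemma codeK (A B : finType) (a0 : A) (b0 : B) :
  #|A| <= #|B| -> cancel (code b0) (code a0 : B -> A).
Proof.
move=> leAB a; rewrite /code.
have lt_a : enum_rank a < #|B| := leq_trans (ltn_ord _) leAB.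
rewrite -[nth b0 _ _](enum_val_nth b0 (Ordinal lt_a)) enum_valK /=.
by rewrite -enum_val_nth enum_rankK.
Qed.

(* A verifier whose coins, states and annotation are not yet encoded by bits. *)
Record machine (U G T : Type) := Machine {
  coin : finType;
  state : finType;
  start : coin -> state;
  on_item : coin -> state -> U -> state;
  on_record : coin -> state -> G -> state;
  verdict : coin -> state -> option T
}.

Definition mrun (U G T : Type) (M : machine U G T) (A : seq U) (g : seq G)
    (r : coin M) : option T :=
  verdict r (foldl (on_record r) (foldl (on_item r) (start r) A) g).

(** * Parallel repetition *)

Section Repeat.

Variables (U G T : Type) (k : nat) (M : machine U G T).

Let lift X (step : coin M -> state M -> X -> state M) :
    {ffun 'I_k.+1 -> coin M} -> {ffun 'I_k.+1 -> state M} -> X ->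
    {ffun 'I_k.+1 -> state M} :=
  fun r s x => [ffun j => step (r j) (s j) x].

(** The copies share the stream and the annotation but have independent coins, and bot from one copy
    is bot for all. Having [k.+1] copies guarantees a copy [ord0] whose answer can be taken. *)
Definition repeated : machine U G T := Machine
  (fun r : {ffun 'I_k.+1 -> coin M} => [ffun j => start (r j)])
  (lift (on_item (m := M))) (lift (on_record (m := M)))
  (fun r s => if [forall j, verdict (r j) (s j)] then verdict (r ord0) (s ord0)
              else None).

Lemma repeated_run A g (r : coin repeated) :
  mrun A g r =
  if [forall j, mrun (M := M) A g ((r : {ffun _}) j)]
  then mrun (M := M) A g ((r : {ffun _}) ord0) else None.
Proof.
have lift_foldl X step (xs : seq X) s j :
    foldl (lift step r) s xs j = foldl (step (r j)) (s j) xs.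
  by elim: xs s => //= x xs IH s; rewrite IH ffunE.
by rewrite /mrun /=; under eq_forallb => j do rewrite !lift_foldl ffunE;
  rewrite !lift_foldl ffunE.
Qed.

Lemma repeated_valid (A : seq U) (g : seq G) (t : T) :
  (forall r : coin M, mrun A g r = Some t) ->
  forall r : coin repeated, mrun A g r = Some t.
Proof.
move=> all_t r; rewrite repeated_run all_t.
by case: forallP => // -[] j; rewrite all_t.
Qed.

Lemma repeated_error (A : seq U) (g : seq G) :
  #|[set r : coin repeated | mrun A g r]|
    <= #|[set r : coin M | mrun A g r]| ^ k.+1.
Proof.
rewrite -[in leqRHS](card_ord k.+1) [in leqRHS]cardsE -card_ffun_forall.
rewrite subset_leq_card //.
apply/subsetP => r; rewrite !inE repeated_run.
by case: ifP => // /forallP all_r _; apply/forallP => j; apply: all_r.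
Qed.

End Repeat.

Lemma val_insub_bseq (n : nat) (T : Type) (s : seq T) :
  size s <= n -> insub_bseq n s = s :> seq T.
Proof. by move=> le_s; apply: insubdK. Qed.

(** * From records to bits, for memory and annotation *)

Section Bitwise.

Variables (U G T : Type).
Variables (M : machine U G T) (L k b : nat) (r0 : coin M) (s0 : state M).
Variable (decode : L.-tuple bool -> G).

Definition push (r : coin M) (s : state M * L.-bseq bool) (x : bool) :
    state M * L.-bseq bool :=
  let buf := rcons s.2 x in
  if insub buf : option (L.-tuple bool) is Some t
  then (on_record r s.1 (decode t), [bseq])
  else (s.1, insub_bseq L buf).

Let zeros j : j.-tuple bool := nseq_tuple j false.
Let load (t : b.-tuple bool) : state M * L.-bseq bool := code (s0, [bseq]) t.
Let save (s : state M * L.-bseq bool) : b.-tuple bool := code (zeros b) s.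
Let draw (t : k.-tuple bool) : coin M := code r0 t.

Definition bitwise : verifier U T := Verifier
  (fun r : k.-tuple bool => save (start (draw r), [bseq]))
  (fun r s x => save (on_item (draw r) (load s).1 x, (load s).2))
  (fun r s x => save (push (draw r) (load s) x))
  (fun r s => if nilp (load s).2 then verdict (draw r) (load s).1 else None).

Lemma push_short r s (buf : L.-bseq bool) x :
  size buf + 1 < L -> push r (s, buf) x = (s, insub_bseq L (rcons buf x)).
Proof.
move=> lt_L; rewrite /push /=; case: insubP => // t; rewrite size_rcons => /eqP.
by lia.
Qed.

Lemma push_record (t : L.-tuple bool) r s :
  0 < L -> foldl (push r) (s, [bseq]) t = (on_record r s (decode t), [bseq]).
Proof.
move=> L_gt0; have [t' [x tE]] : exists t' x, tval t = rcons t' x.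
  case/lastP: (tval t) (size_tuple t) => [E|t' x _]; last by exists t', x.
  by rewrite -E in L_gt0.
have size_t' : (size t').+1 = L by rewrite -(size_rcons _ x) -tE size_tuple.
suff short : forall a, size a <= size t' ->
    foldl (push r) (s, [bseq]) a = (s, insub_bseq L a).
  rewrite tE foldl_rcons short // /push /= val_insub_bseq -?size_t' //.
  by rewrite -tE valK.
move=> a; elim/last_ind: a => [_ | a y IH]; first by rewrite /insub_bseq /= valKd.
rewrite size_rcons foldl_rcons => lt_a.
rewrite IH ?(ltnW lt_a) //.
rewrite push_short insubdK ?inE //; lia.
Qed.

Lemma push_records (g : seq (L.-tuple bool)) r s : 0 < L ->
  foldl (push r) (s, [bseq]) (flatten (map val g))
  = (foldl (on_record r) s (map decode g), [bseq]).
Proof.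
by move=> L_gt0; elim: g s => //= t g IH s; rewrite foldl_cat push_record // IH.
Qed.

(** How bits group into records depends on the annotation alone, not on coins or states. Soundness
    against lists of records therefore extends to arbitrary bit strings. *)
Lemma push_decode (a : seq bool) :
  exists g buf, forall r s,
    foldl (push r) (s, [bseq]) a = (foldl (on_record r) s g, buf).
Proof.
elim/last_ind: a => [|a x [g [buf IH]]]; first by exists [::], [bseq].
case: (insubP (L.-tuple bool) (rcons buf x)) => [t _ tE | out].
  exists (rcons g (decode t)), [bseq] => r s.
  by rewrite !foldl_rcons IH /push -tE valK.
exists g, (insub_bseq L (rcons buf x)) => r s.
by rewrite foldl_rcons IH /push insubN.
Qed.

Hypothesis card_mem : #|{: state M * L.-bseq bool}| <= 2 ^ b.

Let saveK : cancel save load.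
Proof. by apply: codeK; rewrite card_tuple card_bool. Qed.

Lemma bitwise_run A a (r : k.-tuple bool) :
  run (V := bitwise) A a r =
  let s := foldl (push (draw r))
                 (foldl (on_item (draw r)) (start (draw r)) A, [bseq]) a in
  if nilp s.2 then verdict (draw r) s.1 else None.
Proof.
have items s buf : foldl (read_item (v := bitwise) r) (save (s, buf)) A
    = save (foldl (on_item (draw r)) s A, buf).
  by elim: A s => //= x A IH s; rewrite saveK IH.
have bits s : foldl (read_annot (v := bitwise) r) (save s) a
    = save (foldl (push (draw r)) s a).
  by elim: a s => //= x a IH s; rewrite saveK IH.
by rewrite /run /= items bits saveK.
Qed.

End Bitwise.

(** The cost is the least [c] such that each stream has a convincing annotation of at most [c] bits;
    a finite choice over the streams assembles these annotations into one helper. *)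
Lemma help_cost_exists (U : finType) (T : eqType) (m : nat)
    (f : m.-tuple U -> T) (V : verifier U T) (H : helper U m) :
  valid_helper f V H ->
  exists2 c, is_help_cost f V c & c <= annotation_length H.
Proof.
move=> validH.
pose ok c := [forall A : m.-tuple U, exists a : {bseq c of bool},
  prob (fun r => run (V := V) A a r == Some (f A)) == 1%R].
have okH (H' : helper U m) : valid_helper f V H' -> ok (annotation_length H').
  move=> validH'; apply/forallP => A; apply/existsP.
  have le_H : size (H' A) <= annotation_length H'.
    exact: (leq_bigmax (F := fun A => size (H' A))).
  by exists (Bseq le_H); apply/eqP/validH'.
have ex_ok : exists c, ok c by exists (annotation_length H); apply: okH.
case: (ex_minnP ex_ok) => c ok_c min_c; exists c; last exact/min_c/okH.
split=> [|H' /okH/min_c //].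
have [h hE] : exists h : m.-tuple U -> {bseq c of bool},
    forall A : m.-tuple U,
    prob (fun r => run (V := V) A (h A) r == Some (f A)) = 1%R.
  apply: (@fin_all_exists _ (fun=> {bseq c of bool})
    (fun (A : m.-tuple U) a =>
       prob (fun r => run (V := V) A a r == Some (f A)) = 1%R)) => A.
  by have /existsP[a /eqP] := forallP ok_c A; exists a.
exists (fun A => h A) => //; apply/eqP; rewrite eqn_leq min_c ?andbT.
  by apply/bigmax_leqP => A _; apply: size_bseq.
by apply: (okH (fun A => h A)).
Qed.

Lemma bitwise_valid (U : finType) (G : Type) (T : eqType) (m : nat)
    (f : m.-tuple U -> T) (M : machine U G T) (L k b l : nat)
    (r0 : coin M) (s0 : state M)
    (encode : G -> L.-tuple bool) (decode : L.-tuple bool -> G) :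
  0 < L -> #|coin M| = 2 ^ k -> #|{: state M * L.-bseq bool}| <= 2 ^ b ->
  cancel encode decode ->
  (forall A : m.-tuple U,
     exists2 g, size g <= l & forall r, mrun (M := M) A g r = Some (f A)) ->
  (forall (A : m.-tuple U) g,
     (forall r, mrun (M := M) A g r = Some (f A)) \/
     3 * #|[set r | mrun (M := M) A g r]| <= #|coin M|) ->
  let V := bitwise k b r0 s0 decode in
  valid_verifier f V /\ exists2 c, is_help_cost f V c & c <= L * l.
Proof.
move=> L_gt0 cardC cardS encodeK complete sound V.
have runE A a : exists ok g, forall r,
    run (V := V) A a r = if ok then mrun A g (code r0 r : coin M) else None.
  have [g [buf pushE]] := push_decode M decode a.
  by exists (nilp buf), g => r; rewrite bitwise_run // pushE.
have [h hE] : exists h : m.-tuple U -> seq G, forall A : m.-tuple U,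
    size (h A) <= l /\ forall r, mrun (M := M) A (h A) r = Some (f A).
  apply: (@fin_all_exists _ (fun=> seq G) (fun (A : m.-tuple U) g =>
    size g <= l /\ forall r, mrun (M := M) A g r = Some (f A))) => A.
  by have [g] := complete A; exists g.
pose H A := flatten (map val (map encode (h A))).
have validH : valid_helper f V H.
  move=> A; apply/prob_eq1 => r; rewrite bitwise_run // push_records //=.
  by rewrite mapK //; have [_ /(_ (code r0 r))] := hE A; rewrite /mrun => ->.
split; last first.
  have [c cost_c le_c] := help_cost_exists validH; exists c => //.
  apply: leq_trans le_c _; apply/bigmax_leqP => A _.
  rewrite size_flatten /shape -!map_comp sumnE big_map.
  under eq_bigr => g _ do rewrite /= size_tuple.
  by rewrite big_const_seq iter_addn_0 count_predT leq_mul2l (hE A).1 orbT.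
split=> [|H' A]; first by exists H.
have [ok [g {}runE]] := runE A (H' A).
(* If an incomplete record is left in the buffer, every run outputs bot. *)
case: ok runE => runE; last first.
  right; rewrite /helper_invalid_for prob_le_third.
  have noneE r : (run (V := V) A (H' A) r != None) = false by rewrite runE.
  by rewrite (_ : [set r | _] = set0) ?cards0 //; apply/setP => r;
    rewrite in_set0 in_set noneE.
have [all_ok | few] := sound A g.
  by left; apply/prob_eq1 => r; rewrite runE all_ok.
right; rewrite /helper_invalid_for prob_le_third card_tuple card_bool -cardC.
apply: leq_trans few; rewrite leq_mul2l /=.
(* Since there are exactly 2^k coins, distinct random strings draw distinct coins, and the count of
   bad coins bounds the count of bad strings. *)
have inj_draw : injective (fun r : k.-tuple bool => code r0 r : coin M).
  apply: (can_inj (g := code (nseq_tuple k false))); apply: codeK.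
  by rewrite cardC card_tuple card_bool.
rewrite -(card_imset _ inj_draw) subset_leq_card //; apply/subsetP => r.
case/imsetP=> r' r'S ->.
have : run (V := V) A (H' A) r' != None by move: r'S; rewrite in_set.
by rewrite in_set runE; case: mrun.
Qed.

Lemma repeated_bitwise_valid (U : finType) (G : Type) (T : eqType) (m : nat)
    (f : m.-tuple U -> T) (M : machine U G T) (L k b l : nat)
    (r0 : coin (repeated 3 M)) (s0 : state (repeated 3 M))
    (encode : G -> L.-tuple bool) (decode : L.-tuple bool -> G) :
  0 < L -> #|coin M| = 2 ^ k -> #|state M| ^ 4 * 2 ^ L.+1 <= 2 ^ b ->
  cancel encode decode ->
  (forall A : m.-tuple U,
     exists2 g, size g <= l & forall r, mrun (M := M) A g r = Some (f A)) ->
  (forall (A : m.-tuple U) g,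
     (forall r, mrun (M := M) A g r = Some (f A)) \/
     4 * #|[set r | mrun (M := M) A g r]| <= 3 * #|coin M|) ->
  let V := bitwise (k * 4) b r0 s0 decode in
  valid_verifier f V /\ exists2 c, is_help_cost f V c & c <= L * l.
Proof.
move=> L_gt0 cardC cardS encodeK complete sound; apply: bitwise_valid => //.
- by rewrite card_ffun card_ord cardC expnM.
- rewrite card_prod card_ffun card_ord; apply: leq_trans cardS.
  rewrite leq_mul2l card_bseq card_bool; apply/orP; right.
  by have := predn_exp 2 L.+1; rewrite mul1n => <-; apply: leq_pred.
- move=> A; have [g le_g all_ok] := complete A; exists g => //.
  exact: repeated_valid.
move=> A g; have [all_ok | few] := sound A g; first by left; apply: repeated_valid.
right; have := @repeated_error _ _ _ 3 M A g; rewrite card_ffun card_ord.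
move: few; set e := #|_|; set c := #|coin M|; set e4 := #|_| => few le_e4.
(* Four copies suffice because 3 * 3^4 = 243 <= 256 = 4^4; three would not. *)
have : (4 * e) ^ 4 <= (3 * c) ^ 4 by rewrite leq_exp2r.
rewrite !expnMn; move: (e ^ 4) (c ^ 4) le_e4 => x y; lia.
Qed.

(** * Certified distances *)

Section HopDistancePotential.

Variables (S : finType) (e : rel S).

Lemma hop_distance_Some (x z : S) (k : nat) :
  hop_distance e x z = Some k ->
  (exists p, [/\ path e x p, last x p = z & size p = k]) /\
  (forall p, path e x p -> last x p = z -> k <= size p).
Proof.
rewrite /hop_distance; case: {-}_ / idP => // xz [<-].
case: ex_minnP => d /existsP[p /andP[e_p /eqP last_p]] min_d; split.
  by exists p; rewrite size_tuple.
move=> p' e_p' last_p'; apply: min_d; apply/existsP; exists (in_tuple p').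
by rewrite e_p' last_p' eqxx.
Qed.

Lemma hop_distance_path (x : S) (p : seq S) :
  path e x p -> exists2 k, hop_distance e x (last x p) = Some k & k <= size p.
Proof.
move=> e_p; case E: (hop_distance e x (last x p)) => [k|].
  by exists k => //; have [_] := hop_distance_Some E; apply.
move: E; rewrite /hop_distance; case: {-}_ / idP => // not_xz _.
by case: not_xz; apply/connectP; exists p.
Qed.

(* Distances are encoded by numbers that avoid n, with every number above n
   standing for infinity: a jump across an edge by at most one then cannot
   lead from a finite to an infinite distance. *)
Definition potential (n : nat) (x : S) (d : S -> nat) : Prop :=
  [/\ forall z, (d z == 0) = (z == x),
      forall y z, e y z -> d z <= d y + 1,
      forall z, d z != n &
      forall z, 0 < d z < n -> exists2 y, e y z & d z = d y + 1].

(** Descending through predecessors from [z] yields a walk of length [d z]. Along any walk from [x]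
    the number grows by at most one per step and cannot jump over [n], so it stays finite and is at
    most the length of the walk. *)
Lemma potential_hop_distance (n : nat) (x : S) (d : S -> nat) : potential n x d ->
  forall z, hop_distance e x z = if d z < n then Some (d z) else None.
Proof.
case=> d0 step ne_n pred_d.
have reach z : d z < n ->
    exists p, [/\ path e x p, last x p = z & size p = d z].
  move: {2}(d z) (erefl (d z)) => k; elim: k z => [|k IH] z dz lt_n.
    by exists [::]; rewrite dz; split=> //; apply/esym/eqP; rewrite -d0 dz.
  have [y e_yz dzy] : exists2 y, e y z & d z = d y + 1.
    by apply: pred_d; rewrite lt_n dz.
  have [p [e_p last_p size_p]] : exists p, [/\ path e x p, last x p = y & size p = d y].
    by apply: IH; lia.
  exists (rcons p z); rewrite rcons_path last_rcons size_rcons e_p last_p size_p.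
  by rewrite e_yz dzy addn1.
have far p : path e x p -> d (last x p) < n /\ d (last x p) <= size p.
  elim/last_ind: p => [_ | p z IH].
    have /eqP E : d x == 0 by rewrite d0.
    by have := ne_n x; rewrite /= E; lia.
  rewrite rcons_path last_rcons size_rcons => /andP[/IH[lt_n le_d] /step le_z].
  by have := ne_n z; lia.
move=> z; case: ifP => [/reach[p [e_p last_p size_p]] | not_lt].
  have [k Ek le_k] := hop_distance_path e_p; rewrite last_p in Ek.
  have [[q [e_q last_q size_q]] _] := hop_distance_Some Ek.
  have [_] := far q e_q; rewrite last_q Ek => le_d; congr Some; lia.
case E: hop_distance => [k|] //.
have [[q [e_q last_q _]] _] := hop_distance_Some E.
by have [] := far q e_q; rewrite last_q not_lt.
Qed.

Definition hop_number (n : nat) (x z : S) : nat :=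
  if hop_distance e x z is Some k then k else n.+1.

(** A shortest walk repeats no node, so finite distances are below [n] and the value [n.+1] for
    infinity leaves [n] free. The predecessor of a node is the last but one node on a shortest
    walk. *)
Lemma hop_number_potential (n : nat) (x : S) : #|S| <= n ->
  potential n x (hop_number n x) /\ forall z, hop_number n x z <= n.+1.
Proof.
move=> le_n.
have lt_n z k : hop_distance e x z = Some k -> k < n.
  case/hop_distance_Some=> [[p [e_p last_p _]] min_k].
  case/shortenP: e_p last_p => p' e_p' uniq_p' _ last_p'.
  apply: leq_ltn_trans (min_k _ e_p' last_p') _.
  by apply: leq_trans le_n; rewrite -/(size (x :: p')) -(card_uniqP uniq_p') max_card.
have le_n1 z : hop_number n x z <= n.+1.
  by rewrite /hop_number; case E: hop_distance => [k|] //; have := lt_n _ _ E; lia.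
split=> //; split=> [z | y z e_yz | z | z]; rewrite /hop_number.
- apply/eqP/eqP => [|->].
    case E: hop_distance => [k|] // k0; rewrite k0 in E.
    by have [[[|? ?] [//]]] := hop_distance_Some E.
  by have [k -> ] := @hop_distance_path x [::] isT; rewrite leqn0 => /eqP.
- case E: (hop_distance e x y) => [k|]; last first.
    by have := le_n1 z; rewrite /hop_number; case: hop_distance => //; lia.
  have [[p [e_p last_p size_p]] _] := hop_distance_Some E.
  have [|k'] := @hop_distance_path x (rcons p z).
    by rewrite rcons_path e_p last_p.
  by rewrite last_rcons => ->; rewrite size_rcons size_p addn1.
- case E: hop_distance => [k|]; last by rewrite eq_sym; lia.
  by have := lt_n _ _ E; rewrite neq_ltn => ->.
case E: hop_distance => [k|]; last by lia.
have [[p [e_p last_p size_p]] min_k] := hop_distance_Some E.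
case/andP=> k_gt0 _; case/lastP: p e_p last_p size_p => [|p y].
  by move=> _ _ /= E0; rewrite -E0 in k_gt0.
rewrite rcons_path last_rcons size_rcons => /andP[e_p e_y] y_z size_p; subst y.
exists (last x p) => //; have [k' E' le_k'] := hop_distance_path e_p.
rewrite E'; have [[q [e_q last_q size_q]] _] := hop_distance_Some E'.
have := min_k (rcons q z); rewrite rcons_path last_rcons size_rcons e_q last_q e_y.
by move=> /(_ isT erefl); lia.
Qed.

(** Cutting off at [n] turns the maximum of numbers into [max_distance], where infinity absorbs;
    [0 < n] sends the empty maximum 0 to [Some 0]. *)
Lemma rel_diameter_potential (n : nat) (d : S -> S -> nat) :
  0 < n -> (forall x, potential n x (d x)) ->
  let k := \max_(p : S * S) d p.1 p.2 in
  rel_diameter e = if k < n then Some k else None.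
Proof.
move=> n_gt0 pot /=; pose g k := if k < n then Some k else None.
have gM : {morph g : i j / maxn i j >-> max_distance i j}.
  move=> i j; rewrite /g gtn_max.
  by case: (i < n); case: (j < n).
rewrite -/(g _) (big_morph g gM (_ : g 0 = Some 0)); last by rewrite /g n_gt0.
by apply: eq_bigr => -[x z] _; rewrite (potential_hop_distance (pot x)).
Qed.

End HopDistancePotential.

Lemma diameter_few_edges (n m : nat) (A : m.-tuple ('I_n * 'I_n)) :
  m.+1 < n -> diameter A = None.
Proof.
move=> lt_n; case D: (diameter A) => [k|] //; exfalso.
have near x y : exists k, hop_distance (stream_adj A) x y = Some k.
  have : bounded k (diameter A) by rewrite D /=.
  by move/rel_diameter_bounded/(_ x y); case: hop_distance => // j; exists j.
have n_gt0 : 0 < n by lia.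
pose x := Ordinal n_gt0; pose d := hop_number (stream_adj A) n x.
have [pot _] := hop_number_potential (stream_adj A) x (eq_leq (card_ord n)).
have [d0 _ _ pred_d] := pot.
(* An edge of a shortest-path tree is determined by its far end. *)
pose far_end (a : 'I_n * 'I_n) := if d a.1 < d a.2 then a.2 else a.1.
have : {subset [seq z <- enum 'I_n | z != x] <= map far_end A}.
  move=> z; rewrite mem_filter -d0 => /andP[dz _].
  have lt_z : 0 < d z < n.
    rewrite lt0n dz /=; have [k' Ek'] := near x z.
    by have := potential_hop_distance pot z; rewrite Ek'; case: ifP.
  have [y /orP[yz | zy] dzy] := pred_d z lt_z; apply/mapP.
    by exists (y, z) => //; rewrite /far_end /= /d dzy addn1 ltnS leqnn.
  exists (z, y) => //; rewrite /far_end /= /d dzy ifF //.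
  by lia.
move/uniq_leq_size; rewrite filter_uniq ?enum_uniq // size_map size_tuple.
move=> /(_ isT); rewrite size_filter -[count _ _]/(count (predC (pred1 x)) _).
have := count_predC (pred1 x) (enum 'I_n).
rewrite size_enum_ord count_uniq_mem ?enum_uniq // mem_enum inE.
by move: (count _ _) => j; lia.
Qed.

(** * Locally checkable certificates for all distances *)

Section Certificate.

Variables n m : nat.

Notation word := 'Z_(2 * m).+2.
Notation node := 'I_n.

(** Both orientations count, which makes the weight symmetric; a self-loop weighs 2 per
    occurrence. *)
Definition weight (A : seq (node * node)) (p : node * node) : nat :=
  count_mem p A + count_mem (p.2, p.1) A.

(* The record for a pair (z, x): the weight of (z, x), the encoded distance d
   from x to z, and the numbers of neighbours of z, counted with their weights,
   at distances d - 1, d and d + 1 from x. *)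
Definition record : finType := (word * 'I_n.+2 * {ffun 'I_3 -> word})%type.
Definition edge (g : record) : word := g.1.1.
Definition dist (g : record) : nat := g.1.2.
Definition level (g : record) (j : 'I_3) : word := g.2 j.

(** These are the parts of [potential] visible in a single record. The bounded jump across edges is
    left to the level identities. *)
Definition check (p : node * node) (g : record) : bool :=
  [&& dist g != n, (dist g == 0) == (p.1 == p.2) &
      (0 < dist g < n) ==> (level g ord0 != 0%R)].

(** Index [j] stands for distance [dist g + j - 1], with the 1 moved to the other side to avoid
    truncated subtraction. The value is 0 when [k] is more than one step away from [dist g]. *)
Definition level_at (g : record) (k : nat) : word :=
  (\sum_j level g j * (k.+1 == (dist g + j)%N)%:R)%R.

Section Stream.

Variables (A : m.-tuple (node * node)) (rc : node * node -> record).

Definition edge_error (p : node * node) : word :=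
  (edge (rc p) - (weight A p)%:R)%R.

Definition level_error (y : node) (q : node * 'I_n.+2) : word :=
  (\sum_z edge (rc (z, y)) * (dist (rc (z, q.1)) == q.2)%:R
   - level_at (rc (y, q.1)) q.2)%R.

Lemma weight_gt0 x y : (0 < weight A (x, y)) = stream_adj A x y.
Proof. by rewrite /weight addn_gt0 -!has_count !has_pred1. Qed.

Lemma weight_sum y : \sum_z weight A (z, y) <= 2 * m.
Proof.
rewrite big_split /= mul2n -addnn leq_add //.
  rewrite -[leqRHS](size_tuple A).
  apply: (@leq_trans (count (fun a => a.2 == y) A)); last exact: count_size.
  elim: (tval A) => [|[a b] B IH] /=; first by rewrite big1.
  rewrite big_split /= leq_add //.
  case: eqP => [->|/eqP/negPf by_]; last first.
    by rewrite big1 // => z _; rewrite xpair_eqE by_ andbF.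
  by rewrite (bigD1 a) //= eqxx big1 // => z /negPf za; rewrite xpair_eqE eq_sym za.
rewrite -[leqRHS](size_tuple A).
apply: (@leq_trans (count (fun a => a.1 == y) A)); last exact: count_size.
elim: (tval A) => [|[a b] B IH] /=; first by rewrite big1.
rewrite big_split /= leq_add //.
case: eqP => [->|/eqP/negPf ay]; last first.
  by rewrite big1 // => z _; rewrite xpair_eqE ay.
by rewrite (bigD1 b) //= eqxx big1 // => z /negPf zb;
  rewrite xpair_eqE [b == z]eq_sym zb andbF.
Qed.

Lemma word_natr_eq0 k : k <= 2 * m -> (k%:R == 0 :> word)%R = (k == 0).
Proof.
by move=> le_k; rewrite -val_eqE /= val_Zp_nat // modn_small //; lia.
Qed.

(** The weights at [y] add up to at most 2m, below the modulus 2m + 2, so nothing wraps around and a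
    vanishing sum has only vanishing terms. *)
Lemma weighted_sum_eq0 (y : node) (P : pred node) :
  (\sum_z (weight A (z, y))%:R * (P z)%:R == 0 :> word)%R
  = [forall z, stream_adj A z y ==> ~~ P z].
Proof.
have -> : (\sum_z (weight A (z, y))%:R * (P z)%:R
           = (\sum_z weight A (z, y) * P z)%:R :> word)%R.
  by rewrite natr_sum; apply: eq_bigr => z _; rewrite natrM.
rewrite word_natr_eq0; last first.
  apply: leq_trans (weight_sum y); apply: leq_sum => z _.
  by case: (P z); rewrite ?muln1 ?muln0.
rewrite sum_nat_eq0; apply: eq_forallb => z; rewrite /= muln_eq0 -weight_gt0 lt0n.
by case: (weight _ _ == 0); case: (P z).
Qed.

Hypotheses (edges_ok : forall p, edge_error p = 0%R)
           (levels_ok : forall y q, level_error y q = 0%R)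
           (checks_ok : forall p, check p (rc p)).

(** A neighbour of [y] at distance [k] makes the weighted sum nonzero, hence also [level_at] at [k],
    which forces [k] within one step of the distance of [y]. Conversely, the nonzero level 0
    demanded by [check] exhibits a neighbour one step closer. *)
Lemma certified_potential x : potential (stream_adj A) n x (fun z => dist (rc (z, x))).
Proof.
have e_sym : symmetric (stream_adj A) by move=> a b; rewrite /stream_adj orbC.
have levelE y (k : 'I_n.+2) :
    level_at (rc (y, x)) k
    = (\sum_z (weight A (z, y))%:R * (dist (rc (z, x)) == k)%:R)%R.
  have /eqP := levels_ok y (x, k); rewrite subr_eq0 => /eqP <-.
  by apply: eq_bigr => z _; have /eqP := edges_ok (z, y); rewrite subr_eq0 => /eqP ->.
have near y z : stream_adj A z y -> dist (rc (z, x)) <= dist (rc (y, x)) + 1 /\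
    dist (rc (y, x)) <= dist (rc (z, x)) + 1.
  move=> zy; pose k : 'I_n.+2 := (rc (z, x)).1.2.
  have : level_at (rc (y, x)) k != 0%R.
    rewrite levelE weighted_sum_eq0; apply/forallPn; exists z.
    by rewrite zy /= negbK.
  case: (boolP [exists j : 'I_3, k.+1 == dist (rc (y, x)) + j]).
    case/existsP=> j /eqP; have := ltn_ord j; rewrite /k -/(dist (rc (z, x))); lia.
  move=> /existsPn none /eqP[]; rewrite /level_at big1 // => j _.
  by rewrite (negPf (none j)) mulr0.
split=> [z | y z yz | z | z lt_z].
- by have /and3P[_ /eqP-> _] := checks_ok (z, x); rewrite eq_sym.
- by have [] := near y z (etrans (e_sym _ _) yz).
- by have /and3P[] := checks_ok (z, x).
have /and3P[_ _] := checks_ok (z, x); rewrite lt_z /= => c0.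
have lt_k : (dist (rc (z, x))).-1 < n.+2 by lia.
have := levelE z (Ordinal lt_k); rewrite /level_at /= big_ord_recl /=.
(* At distance one less than that of [z], only level 0 contributes. *)
rewrite big1 => [|j _]; last first.
  suff /eqP/negPf-> : (dist (rc (z, x))).-1.+1 <> dist (rc (z, x)) + bump 0 j.
    by rewrite mulr0.
  by rewrite /bump leq0n; lia.
rewrite addr0 addn0 prednK ?eqxx; last by case/andP: lt_z.
rewrite mulr1 => c0E; move: c0; rewrite c0E weighted_sum_eq0 => /forallPn[y].
rewrite negb_imply negbK => /andP[yz /eqP dy]; exists y => //.
by rewrite dy addn1 prednK //; case/andP: lt_z.
Qed.

Lemma certified_diameter : 0 < n ->
  let k := \max_p dist (rc p) in diameter A = if k < n then Some k else None.
Proof.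
move=> n_gt0 /=; rewrite /diameter.
rewrite (rel_diameter_potential n_gt0 certified_potential) /=.
suff -> : \max_p dist (rc p) = \max_(p : node * node) dist (rc (p.2, p.1)) by [].
pose swap (p : node * node) := (p.2, p.1).
by rewrite (reindex_inj (h := swap)) // => -[a b] [c d] [-> ->].
Qed.

End Stream.

(** The true weights, distances and counts work: neighbours differ by at most one in distance, so
    each is counted in exactly one of the three levels. *)
Lemma certificate_exists (A : m.-tuple (node * node)) :
  exists rc, [/\ forall p, edge_error A rc p = 0%R,
    forall y q, level_error rc y q = 0%R & forall p, check p (rc p)].
Proof.
pose e := stream_adj A; pose d z x := hop_number e n x z.
have pot x := hop_number_potential e x (eq_leq (card_ord n)).
have lt_d z x : d z x < n.+2 by have [_] := pot x; apply.
have near y z x : e y z -> d z x <= d y x + 1.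
  by have [[_ step _ _] _] := pot x; apply: step.
pose c z x : {ffun 'I_3 -> word} := [ffun j : 'I_3 =>
  \sum_y (weight A (y, z))%:R * ((d y x).+1 == (d z x + j)%N)%:R]%R.
pose rc p : record := ((weight A p)%:R%R, Ordinal (lt_d p.1 p.2), c p.1 p.2).
exists rc; split=> [p | y [x k] | [z x]].
- by rewrite /edge_error /= subrr.
- apply/eqP; rewrite subr_eq0 /level_at /level /= /dist /=; apply/eqP.
  under [RHS]eq_bigr => j _ do rewrite ffunE mulr_suml.
  rewrite exchange_big /=; apply: eq_bigr => z _; rewrite /edge /=.
  have [w0 | w_gt0] := posnP (weight A (z, y)).
    by rewrite w0 mul0r big1 // => j _; rewrite !mul0r.
  have zy : e z y by rewrite /e -weight_gt0.
  have yz : e y z by move: zy; rewrite /e /stream_adj orbC.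
  have le1 := near _ _ x zy; have le2 := near _ _ x yz.
  (* This is the one level of [y] in which [z] is counted. *)
  have lt3 : (d z x).+1 - d y x < 3 by lia.
  have [dk | dk] := eqVneq (d z x) k; last first.
    rewrite mulr0 big1 // => j _; rewrite -mulrA -natrM mulnb.
    by rewrite (_ : _ && _ = false) ?mulr0 //; lia.
  rewrite (bigD1 (Ordinal lt3)) //= big1 => [|j /eqP ne_j].
    rewrite -dk (_ : _ == _ = true) ?mulr1 ?addr0 //; lia.
  rewrite (_ : (d z x).+1 == _ = false) ?mulr0 ?mul0r //; apply/eqP => E.
  by apply: ne_j; apply/val_inj => /=; lia.
have [[d0 _ ne_n pred_d] _] := pot x; apply/and3P; split.
- exact: ne_n.
- by rewrite /dist /= -d0 [_ == 0]eq_sym.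
apply/implyP => /pred_d[y yz dz]; rewrite /level /= ffunE weighted_sum_eq0.
by apply/forallPn; exists y; rewrite /= -/e yz addn0 negbK /d dz addn1.
Qed.

End Certificate.

(** * The protocol *)

Section CheckedFold.

Variables (P G D : Type) (ps : seq P) (ok : P -> G -> bool) (f : D -> P -> G -> D).

(** Records carry no labels: their position decides which element of [ps] they describe, so the
    position is part of the state. [None] is an absorbing failure. *)
Definition checked_step (s : option ('I_(size ps).+1 * D)) (g : G) :
    option ('I_(size ps).+1 * D) :=
  if s is Some (i, d) then
    if drop i ps is p :: _ then
      if ok p g then Some (inord i.+1, f d p g) else None
    else None
  else None.

Lemma checked_fold (g : seq G) (i : 'I_(size ps).+1) (d : D) :
  foldl checked_step (Some (i, d)) g =
  let l := zip (drop i ps) g in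
  if (size g <= size ps - i) && all (fun x => ok x.1 x.2) l
  then Some (inord (i + size g), foldl (fun d x => f d x.1 x.2) d l) else None.
Proof.
have none g' : foldl checked_step None g' = None by elim: g'.
elim: g i d => [|a g IH] i d /=.
  by case: (drop i ps) => [|? ?]; rewrite /= addn0 inord_val.
have := size_drop i ps; case E: (drop i ps) => [|p l] /= size_l.
  by rewrite none -size_l.
rewrite -size_l ltnS; case: (ok p a) => /=; last by rewrite none andbF.
have val_i : (inord i.+1 : 'I_(size ps).+1) = i.+1 :> nat.
  by rewrite inordK // ltnS -subn_gt0 -size_l.
rewrite IH val_i addSnnS subnS -size_l /=.
by rewrite -[i.+1]add1n -drop_drop E /= drop0.
Qed.

End CheckedFold.

(** * The one-pass evaluation of the random test *)

Section Machine.

Variables n m : nat.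

Notation word := 'Z_(2 * m).+2.
Notation node := 'I_n.
Notation record := (record n m).

Definition coins : finType :=
  ({ffun node * node -> bool} * {ffun node -> bool} *
   {ffun node * 'I_n.+2 -> bool})%type.

Section Coins.

Variable r : coins.

Definition gam (p : node * node) : word := (r.1.1 p)%:R%R.
Definition alp (y : node) : word := (r.1.2 y)%:R%R.
Definition bet (q : node * 'I_n.+2) : word := (r.2 q)%:R%R.

End Coins.

(* Largest encoded distance, and three words b, u, w that stand for the single
   accumulated value b + u * w. *)
Definition data : finType := ('I_n.+2 * (word * word * word))%type.

Definition total (d : data) : word := (d.2.1.1 + d.2.1.2 * d.2.2)%R.

Definition local_term (r : coins) (p : node * node) (g : record) : word :=
  (gam r p * edge g
   - alp r p.1 * \sum_(k < n.+2) bet r (p.2, k) * level_at g k)%R.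

(* The product u * w is flushed into b at the start of each row. *)
Definition add_record (r : coins) (d : data) (p : node * node) (g : record) :
    data :=
  let ut := (alp r p.2 * edge g)%R in
  let wt := bet r (p.2, g.1.2) in
  let b := local_term r p g in
  let: (mx, (b0, u0, w0)) := d in
  (if mx < g.1.2 then g.1.2 else mx,
   if p.2 == 0 :> nat then ((b0 + u0 * w0 + b)%R, ut, wt)
   else ((b0 + b)%R, (u0 + ut)%R, (w0 + wt)%R)).

Definition add_item (r : coins) (d : data) (a : node * node) : data :=
  let: (mx, (b0, u0, w0)) := d in
  (mx, ((b0 - gam r a - gam r (a.2, a.1))%R, u0, w0)).

Definition pairs : seq (node * node) :=
  [seq (z, x) | z <- enum 'I_n, x <- enum 'I_n].

Definition mstate : finType := option ('I_(size pairs).+1 * data).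

Definition diameter_machine : machine (node * node) record (option nat) :=
  Machine
    (fun _ : coins => Some (ord0, (ord0, (0, 0, 0)%R)) : mstate)
    (fun r s a => if s is Some (i, d) then Some (i, add_item r d a) else None)
    (fun r s g => checked_step (ps := pairs) (@check n m) (add_record r) s g)
    (fun r s =>
       if s is Some (i, d) then
         if (i == size pairs :> nat) && (total d == 0%R)
         then Some (if d.1 < n then Some (d.1 : nat) else None) else None
       else None).

(** A random combination of all errors, linear in the edge errors and with coefficients of product
    form on the level errors; the machine compares it with 0. *)
Definition test (A : seq (node * node)) (rc : node * node -> record) (r : coins) :
    word :=
  (\sum_p gam r p * (edge (rc p) - (weight A p)%:R)
   + \sum_y alp r y * \sum_q bet r q * level_error rc y q)%R.

Lemma pairs_uniq : uniq pairs.
Proof.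
by apply: allpairs_uniq; rewrite ?enum_uniq // => -[a b] [c d] _ _ /= [-> ->].
Qed.

Lemma mem_pairs p : p \in pairs.
Proof. by case: p => z x; apply: allpairs_f; rewrite mem_enum. Qed.

Lemma size_pairs : size pairs = n * n.
Proof. by rewrite size_allpairs size_enum_ord. Qed.

Lemma fold_items (r : coins) (A : seq (node * node)) (i : 'I_(size pairs).+1)
    (mx : 'I_n.+2) (b : word) :
  foldl (on_item (m := diameter_machine) r) (Some (i, (mx, (b, 0, 0)%R))) A
  = Some (i, (mx, (b - \sum_p gam r p * (weight A p)%:R, 0, 0)%R)).
Proof.
elim: A b => [|a A IH] b /=.
  by rewrite big1 ?subr0 // => p _; rewrite mulr0.
have sum1 q : (\sum_p gam r p * (q == p)%:R = gam r q)%R.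
  rewrite (bigD1 q) //= eqxx mulr1 big1 ?addr0 // => p /negPf pq.
  by rewrite eq_sym pq mulr0.
rewrite IH; congr (Some (_, (_, (_, _, _)))).
rewrite -!addrA -!opprD; congr (_ - _)%R.
rewrite -(sum1 a) -(sum1 (a.2, a.1)) -!big_split /=; apply: eq_bigr => p _.
have -> : ((a.2, a.1) == p) = (a == (p.2, p.1)).
  by case: a p => [a1 a2] [p1 p2]; rewrite !xpair_eqE andbC.
by rewrite -!mulrDr -!natrD /weight /= addnA addnACA.
Qed.

Section Fold.

Variables (r : coins) (rc : node * node -> record).

Let step d p := add_record r d p (rc p).

Lemma fold_max (l : seq (node * node)) d :
  (foldl step d l).1 = maxn d.1 (\max_(p <- l) dist (rc p)) :> nat.
Proof.
elim: l d => [|p l IH] d /=; first by rewrite big_nil maxn0.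
rewrite IH big_cons maxnA; congr maxn.
by case: d => mx [[b u] w] /=; rewrite /maxn /dist; case: ltnP.
Qed.

Lemma fold_nonzero z (xs : seq node) mx b u w : all (fun x : node => x != 0 :> nat) xs ->
  (foldl step (mx, (b, u, w)) [seq (z, x) | x <- xs]).2
  = (b + \sum_(x <- xs) local_term r (z, x) (rc (z, x)),
     u + \sum_(x <- xs) alp r x * edge (rc (z, x)),
     w + \sum_(x <- xs) bet r (x, (rc (z, x)).1.2))%R.
Proof.
elim: xs mx b u w => [|x xs IH] mx b u w /=; first by rewrite !big_nil !addr0.
case/andP=> x_ne0 /IH {}IH.
by rewrite /step /= (negPf x_ne0) IH !big_cons !addrA.
Qed.

(** A row starts at node 0, where the pending product moves into [b] without changing [total] and
    [u], [w] restart; at the end of the row [u * w] is the product of the two row sums. *)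
Lemma fold_row z d :
  total (foldl step d [seq (z, x) | x <- enum 'I_n])
  = (total d + (\sum_x local_term r (z, x) (rc (z, x))
     + (\sum_x alp r x * edge (rc (z, x)))
       * (\sum_x bet r (x, (rc (z, x)).1.2))))%R.
Proof.
have [x0 [xs [enumE x0E xs_ne0]]] : exists x0 xs,
    [/\ enum 'I_n = x0 :: xs, x0 = 0 :> nat & all (fun x : node => x != 0 :> nat) xs].
  case: n z => [[] //|n' _]; exists ord0, (map (lift ord0) (enum 'I_n')).
  by rewrite enum_ordSl; split=> //; apply/allP => _ /mapP[x _ ->].
case: d => mx [[b u] w]; rewrite -!(big_enum _ _) /= /total enumE /= /step /= x0E /=.
by rewrite fold_nonzero //= !big_cons !addrA.
Qed.

Lemma fold_rows (zs : seq node) d :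
  total (foldl step d [seq (z, x) | z <- zs, x <- enum 'I_n])
  = (total d + \sum_(z <- zs) (\sum_x local_term r (z, x) (rc (z, x))
       + (\sum_x alp r x * edge (rc (z, x)))
         * (\sum_x bet r (x, (rc (z, x)).1.2))))%R.
Proof.
elim: zs d => [|z zs IH] d; first by rewrite big_nil addr0.
by rewrite /= foldl_cat IH fold_row big_cons [RHS]addrA.
Qed.

(** Writing [bet] at the claimed distance as a sum over all [k] with an indicator, and exchanging
    sums, turns the products of row sums into the bilinear form of the left-hand sides of the level
    identities. *)
Lemma test_expand (A : seq (node * node)) :
  (- (\sum_p gam r p * (weight A p)%:R)
   + \sum_z (\sum_x local_term r (z, x) (rc (z, x))
       + (\sum_x alp r x * edge (rc (z, x)))
         * (\sum_x bet r (x, (rc (z, x)).1.2))) = test A rc r)%R.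
Proof.
have locE : (\sum_z \sum_x local_term r (z, x) (rc (z, x))
    = \sum_p gam r p * edge (rc p)
      - \sum_y alp r y * \sum_q bet r q * level_at (rc (y, q.1)) q.2)%R.
  rewrite pair_bigA /= sumrB; congr (_ - _)%R.
    by apply: eq_bigr => -[z x].
  rewrite -(pair_bigA _ (fun z x => alp r z *
    \sum_(k < n.+2) bet r (x, k) * level_at (rc (z, x)) k)%R) /=.
  apply: eq_bigr => y _; rewrite -mulr_sumr; congr (_ * _)%R.
  by rewrite pair_bigA; apply: eq_bigr => -[x k].
have prodE : (\sum_z (\sum_x alp r x * edge (rc (z, x)))
                     * (\sum_x bet r (x, (rc (z, x)).1.2))
    = \sum_y alp r y * \sum_q bet r q *
        (\sum_z edge (rc (z, y)) * (dist (rc (z, q.1)) == q.2)%:R))%R.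
  have betE z : (\sum_x bet r (x, (rc (z, x)).1.2)
                = \sum_q bet r q * (dist (rc (z, q.1)) == q.2)%:R)%R.
    transitivity (\sum_x \sum_k bet r (x, k) * (dist (rc (z, x)) == k)%:R)%R.
      2: by rewrite pair_bigA; apply: eq_bigr => -[x k].
    apply: eq_bigr => x _; rewrite (bigD1 (rc (z, x)).1.2) //= eqxx mulr1.
    rewrite big1 ?addr0 // => k; rewrite -val_eqE /= eq_sym => /negPf ne_k.
    by rewrite ne_k mulr0.
  under eq_bigr => z _ do rewrite mulr_suml.
  rewrite exchange_big /=; apply: eq_bigr => y _.
  under eq_bigr => z _ do rewrite -mulrA betE.
  rewrite -mulr_sumr; congr (_ * _)%R.
  under eq_bigr => z _ do rewrite mulr_sumr.
  rewrite exchange_big /=; apply: eq_bigr => q _; rewrite mulr_sumr.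
  by apply: eq_bigr => z _; rewrite mulrCA.
rewrite big_split /= locE prodE /test.
under [in RHS]eq_bigr => p _ do rewrite mulrBr.
under [X in (_ = _ + X)%R]eq_bigr => y _.
  under eq_bigr => q _ do rewrite mulrBr.
  rewrite sumrB mulrBr; over.
rewrite !sumrB -!addrA [LHS]addrCA; congr (_ + (_ + _))%R; exact: addrC.
Qed.

End Fold.

Definition record0 : record := (0%R, ord0, [ffun=> 0%R]).

Lemma machine_run_size (A : seq (node * node)) (g : seq record) r :
  size g != size pairs -> mrun (M := diameter_machine) A g r = None.
Proof.
move=> ne_g; rewrite /mrun fold_items /= checked_fold /= subn0 drop0.
case: ifP => // /andP[le_g _]; rewrite add0n inordK ?ltnS //.
by rewrite (negPf ne_g).
Qed.

Lemma machine_run (A : seq (node * node)) (rc : node * node -> record) r :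
  mrun (M := diameter_machine) A (map rc pairs) r =
  if [forall p, check p (rc p)] && (test A rc r == 0%R)
  then let k := \max_p dist (rc p) in Some (if k < n then Some k else None)
  else None.
Proof.
rewrite /mrun fold_items /= checked_fold /= subn0 drop0 size_map leqnn /=.
have zipE : zip pairs (map rc pairs) = [seq (p, rc p) | p <- pairs].
  by elim: pairs => //= p l ->.
have allE : all (fun x => check x.1 x.2) [seq (p, rc p) | p <- pairs]
            = [forall p, check p (rc p)].
  rewrite all_map; apply/allP/forallP => [ok p | ok p _]; last exact: ok.
  exact/ok/mem_pairs.
have foldE (l : seq (node * node)) d :
    foldl (fun d x => add_record r d x.1 x.2) d [seq (p, rc p) | p <- l]
    = foldl (fun d p => add_record r d p (rc p)) d l.
  by elim: l d => //= p l IH d.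
rewrite zipE allE; case: ifP => //= _; rewrite add0n inordK // eqxx /= foldE.
rewrite fold_rows big_enum fold_max max0n {1}/total /= mulr0 addr0 sub0r.
rewrite test_expand.
suff -> : \max_(p <- pairs) dist (rc p) = \max_p dist (rc p) by [].
rewrite -[RHS]big_enum; apply: perm_big; apply: uniq_perm => [||p].
- exact: pairs_uniq.
- exact: enum_uniq.
by rewrite mem_pairs mem_enum.
Qed.

End Machine.

(** * Error probability of the random test *)

Section Flip.

Variable X : finType.

Definition flip (x0 : X) (b : bool) (r : {ffun X -> bool}) : {ffun X -> bool} :=
  [ffun x => r x (+) (b && (x == x0))].

Lemma flip_inj x0 b : injective (flip x0 b).
Proof. by apply: inv_inj => r; apply/ffunP => x; rewrite !ffunE addbK. Qed.

(** The two sums differ by [c x0] up to sign. Random bits as coefficients avoid any division, so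
    zero divisors in the ring do no harm. *)
Lemma flip_sum (R : nzRingType) (c : X -> R) (k : R) r x0 :
  (forall b, \sum_x (flip x0 b r x)%:R * c x + k = 0)%R -> c x0 = 0%R.
Proof.
have splitE b : (\sum_x (flip x0 b r x)%:R * c x =
    (r x0 (+) b)%:R * c x0 + \sum_(x | x != x0) (r x)%:R * c x)%R.
  rewrite (bigD1 x0) //= ffunE eqxx andbT; congr (_ + _)%R.
  by apply: eq_bigr => x /negPf ne_x; rewrite ffunE ne_x andbF addbF.
move=> sum0; have := etrans (sum0 false) (esym (sum0 true)).
by rewrite !splitE => /addIr/addIr; case: (r x0); rewrite /= mul0r mul1r.
Qed.

End Flip.

(** The four preimages of the complement of [Z] cover [C], and by injectivity none is larger than
    that complement, which thus has at least a quarter of [C]. *)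
Lemma card_four_maps (C : finType) (h : bool * bool -> C -> C) (Z : {set C}) :
  (forall b, injective (h b)) -> (forall r, exists b, h b r \notin Z) ->
  4 * #|Z| <= 3 * #|C|.
Proof.
move=> inj_h avoid.
have : #|C| <= \sum_(b : bool * bool) #|~: Z|.
  apply: (@leq_trans (\sum_(b : bool * bool) #|[set r | h b r \notin Z]|)).
    under eq_bigr => b _ do rewrite -sum1_card big_mkcond.
    rewrite exchange_big -sum1_card; apply: leq_sum => r _ /=.
    by have [b r_b] := avoid r; rewrite (bigD1 b) //= inE r_b.
  apply: leq_sum => b _; rewrite -(card_imset _ (inj_h b)) subset_leq_card //.
  by apply/subsetP => _ /imsetP[r + ->]; rewrite !inE.
rewrite sum_nat_const card_prod card_bool -(cardsC Z); lia.
Qed.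

Section MachineError.

Variables n m : nat.
Hypothesis n_gt0 : 0 < n.

Lemma machine_accepts (A : m.-tuple ('I_n * 'I_n)) rc r :
  (forall p, edge_error A rc p = 0%R) -> (forall y q, level_error rc y q = 0%R) ->
  (forall p, check p (rc p)) ->
  mrun (M := diameter_machine n m) A (map rc (pairs n)) r = Some (diameter A).
Proof.
move=> edges_ok levels_ok checks_ok.
rewrite machine_run (certified_diameter edges_ok levels_ok) //.
have -> : [forall p, check p (rc p)] by apply/forallP.
rewrite /test (eq_bigr (fun=> 0%R)); last first.
  by move=> p _; rewrite -/(edge_error A rc p) edges_ok mulr0.
rewrite big1_eq add0r big1 ?eqxx // => y _.
by rewrite big1 ?mulr0 // => q _; rewrite levels_ok mulr0.
Qed.

Lemma machine_complete (A : m.-tuple ('I_n * 'I_n)) :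
  exists2 g, size g <= n * n &
    forall r, mrun (M := diameter_machine n m) A g r = Some (diameter A).
Proof.
have [rc [edges_ok levels_ok checks_ok]] := certificate_exists A.
exists (map rc (pairs n)); first by rewrite size_map size_pairs.
by move=> r; apply: machine_accepts.
Qed.

(** If all checks and identities hold, the answer is right for every coin. Otherwise a failed check
    rejects always, and a false identity is exposed by flipping the coins that weight it. *)
Lemma machine_sound (A : m.-tuple ('I_n * 'I_n)) (g : seq (record n m)) :
  (forall r, mrun (M := diameter_machine n m) A g r = Some (diameter A)) \/
  4 * #|[set r | mrun (M := diameter_machine n m) A g r]| <= 3 * #|coins n|.
Proof.
have [size_g | ne_g] := eqVneq (size g) (size (pairs n)); last first.
  right; rewrite (_ : [set r | _] = set0) ?cards0 //.
  by apply/setP => r; rewrite !inE machine_run_size.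
pose rc p := nth (record0 n m) g (index p (pairs n)).
have {size_g} -> : g = map rc (pairs n).
  apply: (@eq_from_nth _ (record0 n m)); rewrite ?size_map // => i lt_i.
  pose x0 := Ordinal n_gt0; rewrite size_g in lt_i.
  by rewrite (nth_map (x0, x0)) // /rc index_uniq // pairs_uniq.
set Z := [set r | _].
have ZE r : (r \in Z) = [forall p, check p (rc p)] && (test A rc r == 0%R).
  by rewrite inE machine_run; case: ifP.
have [checks_ok | bad] := boolP [forall p, check p (rc p)]; last first.
  right; rewrite (_ : Z = set0) ?cards0 //.
  by apply/setP => r; rewrite ZE (negPf bad) inE.
rewrite checks_ok /= in ZE.
have [/forallP edges_ok | /forallPn[p0 /eqP bad]] :=
    boolP [forall p, edge_error A rc p == 0%R]; last first.
  right; pose h (b : bool * bool) (r : coins n) : coins n :=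
    (flip p0 b.1 r.1.1, r.1.2, r.2).
  apply: (@card_four_maps (coins n) h Z) => [b | r].
    by move=> [[r1 r2] r3] [[s1 s2] s3] [/flip_inj-> -> ->].
  apply/existsP; apply: contraT => /existsPn all_Z; case: bad.
  apply: (@flip_sum _ _ (edge_error A rc)
    (\sum_y alp m r y * \sum_q bet m r q * level_error rc y q)%R r.1.1 p0) => b.
  by have := all_Z (b, true); rewrite negbK ZE => /eqP.
have {}edges_ok p : edge_error A rc p = 0%R by apply/eqP.
have [/forallP levels_ok | /forallPn[y0 /forallPn[q0 /eqP bad]]] :=
    boolP [forall y, forall q, level_error rc y q == 0%R].
  left=> r; apply: machine_accepts => // [y q | p].
    by apply/eqP; have /forallP := levels_ok y.
  exact: (forallP checks_ok).
right; pose h (b : bool * bool) (r : coins n) : coins n :=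
  (r.1.1, flip y0 b.1 r.1.2, flip q0 b.2 r.2).
apply: (@card_four_maps (coins n) h Z) => [b | r].
  by move=> [[r1 r2] r3] [[s1 s2] s3] [-> /flip_inj-> /flip_inj->].
apply/existsP; apply: contraT => /existsPn all_Z; case: bad.
(* For each [b2] the test is linear in the [alp] coins, so flipping [y0] isolates its coefficient.
   That coefficient is linear in the [bet] coins, and flipping [q0] isolates the level error. *)
apply: (@flip_sum _ _ (level_error rc y0) 0%R r.2 q0) => b2; rewrite addr0.
apply: (@flip_sum _ _ (fun y => \sum_q (flip q0 b2 r.2 q)%:R * level_error rc y q)%R
  0%R r.1.2 y0) => b1; rewrite addr0.
have := all_Z (b1, b2); rewrite negbK ZE /test => /eqP.
rewrite (eq_bigr (fun=> 0%R)) ?big1_eq ?add0r // => p _.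
by rewrite -/(edge_error A rc p) edges_ok mulr0.
Qed.

End MachineError.

(** * The protocol and its costs *)

Lemma constant_valid (U : finType) (T : eqType) (m : nat) (f : m.-tuple U -> T)
    (t : T) : (forall A, f A = t) ->
  let V := Verifier (fun _ : 0.-tuple bool => [tuple])
    (fun _ s (_ : U) => s) (fun _ s _ => s) (fun _ (_ : 0.-tuple bool) => Some t) in
  valid_verifier f V /\ is_help_cost f V 0.
Proof.
move=> fE V; have valid_all H A : helper_valid_for f V H A.
  by apply/prob_eq1 => r; rewrite fE /run /=.
have valid0 : valid_helper f V (fun=> [::]) by move=> A.
split; first by split=> [|H A]; [exists (fun=> [::]) | left].
split=> //; exists (fun=> [::]) => //.
by apply/eqP; rewrite -leqn0; apply/bigmax_leqP.
Qed.

(** A record takes w + 1 bits for the weight, w + 2 for the distance and 3(w + 1) for the levels, in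
    all 5w + 6. One copy of the machine has 6w + 7 bits of state, and 29w + 35 = 4(6w + 7) + (5w +
    7) covers four copies and the buffer. *)
Definition diameter_protocol : graph_protocol (option nat) := fun n m =>
  if m.+1 < n then
    Verifier (fun _ : 0.-tuple bool => [tuple])
      (fun _ s (_ : 'I_n * 'I_n) => s) (fun _ s _ => s)
      (fun _ (_ : 0.-tuple bool) => Some None)
  else
    let w := word_size m in
    bitwise (M := repeated 3 (diameter_machine n m))
      ((n * n + n + n * n.+2) * 4) (29 * w + 35)
      [ffun=> ([ffun=> false], [ffun=> false], [ffun=> false])] [ffun=> None]
      (code (record0 n m) : (5 * w + 6).-tuple bool -> record n m).

Section Sizes.

Variables n m : nat.
Hypothesis le_nm : n <= m.+1.
Notation w := (word_size m).

Let lt_m : m < 2 ^ w.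
Proof. exact: trunc_log_ltn. Qed.

Let word_le : #|'Z_(2 * m).+2| <= 2 ^ w.+1.
Proof.
rewrite card_ord expnS; move: lt_m; set x := 2 ^ w.
by rewrite /Zp_trunc /=; lia.
Qed.

Let dist_le : n.+2 <= 2 ^ (w + 2).
Proof. by rewrite expnD; move: lt_m; set x := 2 ^ w; lia. Qed.

Lemma card_coins : #|coins n| = 2 ^ (n * n + n + n * n.+2).
Proof. by rewrite !card_prod !card_ffun !card_prod !card_ord card_bool !expnD. Qed.

Lemma card_record : #|record n m| <= 2 ^ (5 * w + 6).
Proof.
rewrite !card_prod card_ffun [#|'I_3|]card_ord [#|'I_n.+2|]card_ord.
have -> : 5 * w + 6 = w.+1 + (w + 2) + w.+1 * 3 by lia.
rewrite expnD [2 ^ (w.+1 + _)]expnD expnM; apply: leq_mul; last exact: leq_exp_base.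
exact: leq_mul.
Qed.

Lemma card_mstate : #|mstate n m| <= 2 ^ (6 * w + 7).
Proof.
have pairs_le : (n * n).+1 <= 2 ^ (w + w + 1).
  have le_n : n <= 2 ^ w by apply: leq_trans le_nm lt_m.
  have := leq_mul le_n le_n; rewrite !expnD; have : 0 < 2 ^ w by rewrite expn_gt0.
  by move: (2 ^ w) => x; nia.
have : #|{: 'I_(size (pairs n)).+1 * data n m}| <= 2 ^ (6 * w + 6).
  rewrite !card_prod [#|'I_n.+2|]card_ord [#|'I_(size _).+1|]card_ord size_pairs.
  have -> : 2 ^ (6 * w + 6)
      = 2 ^ (w + w + 1) * (2 ^ (w + 2) * (2 ^ w.+1 * 2 ^ w.+1 * 2 ^ w.+1)).
    by rewrite -!expnD; congr (2 ^ _); lia.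
  by do 4?[apply: leq_mul => //].
rewrite card_option [6 * w + 7]addnS expnS => le_card.
by rewrite mul2n -addnn -add1n leq_add // expn_gt0.
Qed.

Lemma diameter_protocol_valid : 0 < n ->
  valid_verifier (@diameter n m) (diameter_protocol n m) /\
  exists2 c, is_help_cost (@diameter n m) (diameter_protocol n m) c &
             c <= (5 * w + 6) * (n * n).
Proof.
move=> n_gt0; rewrite /diameter_protocol ltnNge le_nm /=.
apply: (@repeated_bitwise_valid _ _ _ _ _ _ _ _ _ _ _ _ (code (nseq_tuple _ false))).
- by rewrite addnS.
- exact: card_coins.
- apply: (@leq_trans ((2 ^ (6 * w + 7)) ^ 4 * 2 ^ (5 * w + 6).+1)).
    by rewrite leq_mul2r leq_exp_base ?orbT // card_mstate.
  by rewrite -expnM -expnD leq_exp2l //; lia.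
- by apply: codeK; rewrite card_tuple card_bool card_record.
- exact: machine_complete.
exact: machine_sound.
Qed.

End Sizes.

Lemma diameter_protocol_hv :
  hv_protocol diameter diameter_protocol (fun n => n ^ 2 * trunc_log 2 n) (fun=> 1).
Proof.
have few n m : m.+1 < n ->
    valid_verifier (@diameter n m) (diameter_protocol n m) /\
    is_help_cost (@diameter n m) (diameter_protocol n m) 0.
  move=> lt_n; rewrite /diameter_protocol lt_n.
  by apply: constant_valid => A; apply: diameter_few_edges.
split=> [n m n_gt0 |].
  have [le_n | lt_n] := leqP n m.+1; last by have [] := few n m lt_n.
  by have [] := diameter_protocol_valid le_n n_gt0.
exists 64 => n m n_gt0; have [le_n | lt_n] := leqP n m.+1; last first.
  have [_ cost0] := few n m lt_n; split.
    by exists 0 => //; apply: words_leq.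
  by rewrite /diameter_protocol lt_n; apply: words_leq.
have w_gt0 : 0 < word_size m by [].
have [_ [c cost_c le_c]] := diameter_protocol_valid le_n n_gt0; split.
  exists c => //; apply: words_leq; apply: leq_trans le_c _.
  (* For n = 1 the logarithm is 0 and the added 1 is what carries the bound. *)
  have : n * n <= n ^ 2 * trunc_log 2 n + 1.
    rewrite -mulnn; have [lt_2 | ge_2] := ltnP n 2; first by nia.
    have : 0 < trunc_log 2 n by rewrite trunc_log_gt0.
    nia.
  move: (n * n) (_ + 1) => x y le_xy.
  apply: (@leq_trans (11 * word_size m * y)); last by nia.
  apply: leq_mul => //; lia.
rewrite /diameter_protocol ltnNge le_n; apply: words_leq.
rewrite /=; lia.
Qed.

Theorem theorem8 :
  (exists P : graph_protocol (option nat),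
     hv_protocol diameter P (fun n => n ^ 2 * trunc_log 2 n) (fun _ => 1))
  /\
  (exists K n0 : nat, forall P : graph_protocol (option nat),
     valid_protocol diameter P ->
     forall n : nat, n0 <= n ->
     exists2 m : nat, m <= n ^ 2 &
     forall c : nat, is_help_cost (@diameter n m) (P n m) c ->
       n ^ 2 <= K * (maxn 1 c * mem_bits (P n m))).
Proof.
split; first by exists diameter_protocol; apply: diameter_protocol_hv.
by exists 640, 16 => P validP n n_ge16; apply: diameter_lower_bound.
Qed.
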